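(* Let $K$ be a field endowed with a rank-one valuation $v$, with valuation domain $V$ and maximal ideal $\mathfrak m$, and let $E$ be a nonempty subset of $V$. Assume that $E$ does not contain any pseudo-divergent sequence or any pseudo-stationary sequence. Then the prime ideals of $\mathrm{Int}(E,V)$ are the following: (1) The nonzero prime ideals lying over the ideal $(0)$ of $V$ are in one-to-one correspondence with the monic irreducible polynomials $q$ of $K[X]$. To the polynomial $q$ corresponds the ideal $$\mathfrak P_q=\{qh\in\mathrm{Int}(E,V)\mid h\in K[X]\}=qK[X]\cap\mathrm{Int}(E,V).$$ (2) The prime ideals lying over the maximal ideal $\mathfrak m$ of $V$ are maximal with residue field isomorphic to $V/\mathfrak m$. They are exactly the ideals of the form $$\mathfrak m_{\mathcal U}=\{f\in\mathrm{Int}(E,V)\mid f^{-1}(\mathfrak m)\in\mathcal U\}$$ where $\mathcal U$ is any ultrafilter on $E$. Consequently, $\dim(\mathrm{Int}(E,V))=2$.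
   Context: The valuation $v$ is rank-one: $v(K^* )$ is a nonzero subgroup of $(\mathbb R,+)$, and $v(0)=\infty$. $\mathrm{Int}(E,V)=\{f\in K[X]\mid f(E)\subseteq V\}$. For $f\in\mathrm{Int}(E,V)$, $f^{-1}(\mathfrak m)$ denotes $\{x\in E\mid f(x)\in\mathfrak m\}$. A prime $\mathfrak P$ of $\mathrm{Int}(E,V)$ lies over a prime $\mathfrak p$ of $V$ if $\mathfrak P\cap V=\mathfrak p$. The dimension is the Krull dimension. A sequence $\{x_n\}_{n\ge0}$ of elements of $V$ is pseudo-divergent if $v(x_n-x_m)<v(x_m-x_l)$ for all $n>m>l\ge0$. A sequence $\{x_n\}_{n\ge0}$ of pairwise distinct elements of $V$ is pseudo-stationary if $v(x_n-x_m)=v(x_m-x_l)$ for all $n>m>l\ge0$. *)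

(* Defs.v *)
From HB Require Import structures.
From mathcomp Require Import all_boot all_order all_algebra.
From mathcomp Require Import ring_quotient.
From mathcomp Require Import boolp classical_sets functions filter reals.
From mathcomp Require Import constructive_ereal.

Set Implicit Arguments.
Unset Strict Implicit.
Unset Printing Implicit Defensive.

Import Order.TTheory GRing.Theory Num.Theory.
Local Open Scope classical_set_scope.
Local Open Scope ring_scope.

(* v(K^* ) is a subset of R by [valuation_pinfty] and [valuationNy], and then a
   subgroup of (R, +) by [valuationM]. *)
Record rank_one_valuation (R : realType) (K : fieldType) := RankOneValuation {
  valuation_fun :> K -> \bar R;
  valuation_pinfty : forall x, valuation_fun x = +oo%E <-> x = 0;
  valuationNy : forall x, valuation_fun x <> -oo%E;
  valuationM : forall x y,
    valuation_fun (x * y) = (valuation_fun x + valuation_fun y)%E;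
  valuationD : forall x y,
    (Order.min (valuation_fun x) (valuation_fun y) <= valuation_fun (x + y)%R)%E;
  valuation_nontrivial : exists2 x, x != 0 & valuation_fun x <> 0%E }.

Arguments valuation_pinfty {R K} r x.
Arguments valuationNy {R K} r x _.

Section ValuationDomain.
Context {R : realType} {K : fieldType}.
Implicit Types (v : rank_one_valuation R K) (E : set K).

Definition val_dom v : {pred K} := fun x => (0 <= v x)%E.

Lemma valuation1 v : v 1 = 0%E.
Proof.
have := valuationM v 1 1; rewrite mulr1.
have := valuationNy v 1; have := (valuation_pinfty v 1).1.
case: (v 1) => [r _ _ [] /eqP | /(_ erefl)/eqP |//].
  by rewrite -subr_eq0 opprD addNKr oppr_eq0 => /eqP ->.
by rewrite oner_eq0.
Qed.

Lemma valuationN1 v : v (-1) = 0%E.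
Proof.
have := valuationM v (-1) (-1); rewrite mulrNN mulr1 valuation1.
case: (v (-1)) => [r [] /esym /eqP|//|//].
by rewrite -mulr2n mulrn_eq0 /= => /eqP ->.
Qed.

Lemma valuationN v x : v (- x) = v x.
Proof. by rewrite -mulN1r valuationM valuationN1 add0e. Qed.

Lemma valuation0 v : v 0 = +oo%E.
Proof. exact/valuation_pinfty. Qed.

Lemma val_dom_subring v : subring_closed (val_dom v).
Proof.
split=> [|x y|x y]; rewrite -!topredE /= /val_dom.
- by rewrite valuation1.
- move=> x0 y0; apply: le_trans (valuationD v _ _).
  by rewrite le_min x0 valuationN.
- by move=> x0 y0; rewrite valuationM adde_ge0.
Qed.

HB.instance Definition _ v :=
  GRing.isSubringClosed.Build K (val_dom v) (val_dom_subring v).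

Record vring v : Type := VRing { vring_val : K; _ : vring_val \in val_dom v }.
HB.instance Definition _ v := [isSub of vring v for @vring_val v].
HB.instance Definition _ v := [Choice of vring v by <:].
HB.instance Definition _ v :=
  [SubChoice_isSubComNzRing of vring v by <:].

Definition vmax v : {pred vring v} := fun x => (0 < v (val x))%E.
Arguments vmax v : clear implicits.

Lemma vmax_idealr v : idealr_closed (vmax v).
Proof.
split=> [||a x y]; rewrite -!topredE /= /vmax.
- by rewrite /= valuation0 lt0y.
- by rewrite rmorph1 valuation1 ltxx.
- move=> x0 y0; rewrite rmorphD rmorphM.
  apply: lt_le_trans (valuationD v _ _).
  rewrite lt_min y0 andbT valuationM (lt_le_trans x0) // leeDr //.
  exact: (valP a).
Qed.

HB.instance Definition _ v := isIdealr.Build (vring v) (vmax v) (vmax_idealr v).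

Definition intval E v : {pred {poly K}} :=
  fun f => `[< forall x, E x -> f.[x] \in val_dom v >].

Lemma intval_subring E v : subring_closed (intval E v).
Proof.
split=> [|f g|f g]; rewrite -!topredE /= /intval.
- by apply/asboolP => x _; rewrite hornerC rpred1.
- move=> /asboolP f0 /asboolP g0; apply/asboolP => x Ex.
  by rewrite hornerD hornerN rpredB ?f0 ?g0.
- move=> /asboolP f0 /asboolP g0; apply/asboolP => x Ex.
  by rewrite hornerM rpredM ?f0 ?g0.
Qed.

HB.instance Definition _ E v :=
  GRing.isSubringClosed.Build {poly K} (intval E v) (intval_subring E v).

Record Int E v :=
  IntPoly { int_val : {poly K}; _ : int_val \in intval E v }.
HB.instance Definition _ E v := [isSub of Int E v for @int_val E v].
HB.instance Definition _ E v := [Choice of Int E v by <:].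
HB.instance Definition _ E v :=
  [SubChoice_isSubComNzRing of Int E v by <:].

Lemma polyC_intval E v (c : vring v) : (val c)%:P \in intval E v.
Proof. by apply/asboolP => x _; rewrite hornerC; exact: valP c. Qed.

Definition int_const E v (c : vring v) : Int E v := IntPoly (polyC_intval E c).

Definition lies_over E v (I : set (Int E v)) (p : set (vring v)) :=
  [set c : vring v | I (int_const E c)] = p.

Definition prime_of_poly E v (q : {poly K}) : set (Int E v) :=
  [set f | exists h : {poly K}, val f = q * h].

Definition preim_max E v (f : Int E v) : set E :=
  [set x : E | (0 < v (val f).[val x]%R)%E].

Definition m_ultra E v (U : set_system E) : set (Int E v) :=
  [set f | U (preim_max f)].

Definition pseudo_divergent v (x : nat -> K) :=
  forall n m l : nat, (l < m < n)%N -> (v (x n - x m)%R < v (x m - x l)%R)%E.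

Definition pseudo_stationary v (x : nat -> K) :=
  injective x /\
  forall n m l : nat, (l < m < n)%N -> v (x n - x m) = v (x m - x l).

End ValuationDomain.

Arguments vmax {R K} v _.

(* The inhabitants of [idealr A] are proper ideals. *)
Definition is_maximal (A : comNzRingType) (I : idealr A) :=
  forall J : idealr A, [set` I] `<=` [set` J] -> [set` J] = [set` I].

Definition ring_isomorphic (A B : nzRingType) :=
  exists phi : {rmorphism A -> B}, bijective phi.

Definition prime_chain (A : comNzRingType) n (P : 'I_n.+1 -> prime_idealr A) :=
  forall i j : 'I_n.+1, (i < j)%N -> [set` P i] `<` [set` P j].

Definition has_krull_dim (A : comNzRingType) (n : nat) :=
  (exists P : 'I_n.+1 -> prime_idealr A, prime_chain P) /\
  forall m (P : 'I_m.+1 -> prime_idealr A), prime_chain P -> (m <= n)%N.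

(* Main.v *)
Require Import Defs.
From HB Require Import structures.
From mathcomp Require Import all_boot all_order all_algebra.
From mathcomp Require Import generic_quotient ring_quotient.
From mathcomp Require Import boolp classical_sets functions cardinality filter.
From mathcomp Require Import reals constructive_ereal.

(** Everything rests on how a polynomial g can vary on E.  The hypothesis on E
    makes every infinite subset S of E cluster: some a in S and some infinite
    part S' of S satisfy v(y - a) = c for y in S' while distinct points of S'
    are strictly closer to each other than c ([infinite_cluster]).  Replacing g
    by the divided difference (g - g(a)) / (X - a) lowers the degree and, on
    S', shifts the relevant valuations by the constant c.  Induction on the
    degree then excludes infinitely many decreasing values of v o g and
    infinitely many values of g at one and the same distance, down to the
    constants, for which both are absurd.  Consequently v o g attains its
    minimum on E ([polynomial_attains_min]), and an integer-valued f takes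
    finitely many residues modulo m ([finite_residues]).

    Let P be a prime of Int(E, V) over m.  If g(E) lies in m, division by a
    value of least valuation gives g = t h with t in m and h integer-valued,
    so g is in P ([max_valued_mem]).  If c_1, ..., c_r represent the residues
    of f, the product of the f - c_i maps E into m, so P contains one factor:
    every f is a constant modulo P ([constant_residue]).  This yields the
    residue field V / m and the maximality of P.  The sets where some h outside
    P takes unit values are nonempty and stable under finite intersection,
    since the complement of P is multiplicative; an ultrafilter U containing
    them satisfies m_U <= P, and maximality of m_U gives equality
    ([lies_over_max_ultra]).

    The primes over 0 are those that survive the inversion of the nonzero
    constants, which turns Int(E, V) into K[X] because E lies in V; this gives
    the ideals P_q.  They are pairwise incomparable, so a chain consists of
    at most 0, one P_q and one maximal ideal; for a in E the chain
    0 < P_(X - a) < m_U, with U principal at a, has this length. *)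

Set Implicit Arguments.
Unset Strict Implicit.
Unset Printing Implicit Defensive.
Import Order.TTheory GRing.Theory Num.Theory.
Local Open Scope classical_set_scope.
Local Open Scope ring_scope.

(** * Finite nets *)

(** Greedy choice: as long as no finite list dominates P, a further element of
    P related by r to all the previous ones can be added.  Used with r a strict
    decrease (whence minima) and with r a separation (whence finitely many
    classes). *)
Lemma finite_net (T : eqType) (P : set T) (r : T -> T -> Prop) :
  ~ (exists x : nat -> T,
       (forall n, P (x n)) /\ forall m n, (m < n)%N -> r (x m) (x n)) ->
  exists2 s : seq T, [set` s] `<=` P &
    forall y, P y -> exists2 z, z \in s & ~ r z y.
Proof.
move=> noseq; apply: contrapT => nonet; apply: noseq.
have /choice[F FP] (s : seq T) :
    exists y, [set` s] `<=` P -> P y /\ forall z, z \in s -> r z y.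
  have [sP|/existsNP[z nz]] := pselect ([set` s] `<=` P);
    last by exists z => /(_ z)/nz.
  apply: contrapT => noy; apply: nonet; exists s => // y Py.
  apply: contrapT => noz; apply: noy; exists y => _; split=> // z zs.
  by apply: contrapT => nrzy; apply: noz; exists z.
pose L n := iter n (fun s => F s :: s) [::].
have LP n : [set` L n] `<=` P.
  elim: n => [|n IHn] z //=; rewrite inE => /orP[/eqP->|/IHn//].
  exact: (FP _ IHn).1.
have memL m n : (m < n)%N -> F (L m) \in L n.
  elim: n => // n IHn; rewrite ltnS leq_eqVlt inE => /orP[/eqP->|/IHn->].
    by rewrite eqxx.
  exact: orbT.
exists (fun n => F (L n)); split=> [n|m n mn]; first exact: (FP _ (LP n)).1.
exact: (FP _ (LP n)).2 (memL _ _ mn).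
Qed.

Lemma infinite_range (T : Type) (x : nat -> T) :
  injective x -> infinite_set (range x).
Proof.
move=> x_inj; rewrite (eq_finite_set (inj_card_eq (in2W x_inj))).
exact: infinite_nat.
Qed.

Lemma attains_min d (T : orderType d) (I : eqType) (P : set I) (f : I -> T) :
  P !=set0 ->
  ~ (exists x : nat -> I,
       (forall n, P (x n)) /\ forall m n, (m < n)%N -> (f (x n) < f (x m))%O) ->
  exists2 b, P b & forall y, P y -> (f b <= f y)%O.
Proof.
move=> [i Pi] /(@finite_net _ P (fun z y => (f y < f z)%O))[s sP sN].
have {}sN y : P y -> exists2 z, z \in s & (f z <= f y)%O.
  by move=> /sN[z zs /negP]; rewrite -leNgt; exists z.
suff [b bs bmin] : exists2 b, b \in s & forall z, z \in s -> (f b <= f z)%O.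
  exists b => [|y /sN[z zs]]; first exact: sP.
  exact/le_trans/bmin.
have [j js _] := sN i Pi; elim: s j js {sP sN} => // a s IHs _ _.
case: s IHs => [_|c s /(_ c (mem_head _ _))[b bs bmin]].
  by exists a => [|z]; rewrite inE // => /eqP->.
have [ab|/ltW ba] := leP (f a) (f b).
  exists a => [|z]; rewrite inE ?eqxx // => /orP[/eqP->//|/bmin].
  exact: le_trans.
by exists b => [|z]; rewrite inE ?bs ?orbT // => /orP[/eqP->|/bmin].
Qed.

(** * Rank-one valuations *)

Section Valuation.
Context {R : realType} {K : fieldType} (v : rank_one_valuation R K).

Lemma valuation_fin x : x != 0 -> exists r : R, v x = r%:E.
Proof.
move=> x0; have := valuation_pinfty v x; have := @valuationNy _ _ v x.
case: (v x) => [r _ _|_ [/(_ erefl)/eqP]|//]; first by exists r.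
by rewrite (negPf x0).
Qed.

Lemma valuationB_ge c x y : (c <= v x -> c <= v y -> c <= v (x - y)%R)%E.
Proof.
move=> cx cy; apply: le_trans (valuationD v _ _).
by rewrite le_min cx valuationN.
Qed.

Lemma valuationB_gt c x y : (c < v x -> c < v y -> c < v (x - y)%R)%E.
Proof.
move=> cx cy; apply: lt_le_trans (valuationD v _ _).
by rewrite lt_min cx valuationN.
Qed.

Lemma valuationBC x y : v (x - y) = v (y - x).
Proof. by rewrite -opprB valuationN. Qed.

(** Two sides of an ultrametric triangle are equal as soon as the third one is
    shorter. *)
Lemma valuationBl x y : (v x < v y)%E -> v (x - y) = v x.
Proof.
move=> xy; apply/eqP; rewrite eq_le valuationB_ge ?(ltW xy) // andbT.
rewrite leNgt; apply/negP => xxy; rewrite -(valuationN v y) in xy.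
by have := valuationB_gt xxy xy; rewrite opprK subrK ltxx.
Qed.

Lemma valuationBr x y : (v y < v x)%E -> v (x - y) = v y.
Proof. by rewrite valuationBC; exact: valuationBl. Qed.

Lemma valuationB_subr_gt c x y z :
  (c < v (x - z)%R -> c < v (y - z)%R -> c < v (x - y)%R)%E.
Proof. by move=> cx /(valuationB_gt cx); rewrite opprB addrA subrK. Qed.

Lemma valuationV x : x != 0 -> v x^-1 = (- v x)%E.
Proof.
move=> x0; have := valuationM v x x^-1; rewrite divff // valuation1.
have [r ->] := valuation_fin x0; have [|s ->] := @valuation_fin x^-1.
  by rewrite invr_eq0.
by case=> /eqP; rewrite eq_sym addrC addr_eq0 => /eqP ->.
Qed.

Lemma valuationX x (r : R) n : v x = r%:E -> v (x ^+ n) = (r *+ n)%:E.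
Proof.
move=> xr; elim: n => [|n IHn]; first by rewrite expr0 valuation1.
by rewrite exprS valuationM IHn xr mulrS.
Qed.

Lemma rank_one_archimedean a b : a != 0 -> (0 < v b)%E ->
  exists n, (v a <= v (b ^+ n)%R)%E.
Proof.
move=> /valuation_fin[r ->].
have [->|/valuation_fin[s bs]] := eqVneq b 0.
  by exists 1%N; rewrite valuation0 leey.
rewrite bs lte_fin => s0; exists (Num.bound `|r / s|).
rewrite (valuationX _ bs) lee_fin -mulr_natl -ler_pdivrMr //.
exact: le_trans (ler_norm _) (ltW (archi_boundP (normr_ge0 _))).
Qed.

Lemma exists_valuation_gt0 : exists2 t, t != 0 & (0 < v t)%E.
Proof.
have [x x0 vx] := valuation_nontrivial v.
have [|vx0] := ltP 0%E (v x); first by exists x.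
exists x^-1; rewrite ?invr_eq0 // valuationV // oppe_gt0 lt_neqAle vx0 andbT.
exact/eqP.
Qed.

Lemma vring_val_ge0 (c : vring v) : (0 <= v (val c))%E.
Proof. exact: (valP c). Qed.

Lemma vring_lift (x : K) : (0 <= v x)%E -> exists c : vring v, val c = x.
Proof. by move=> x0; exists (@VRing _ _ v x x0). Qed.

End Valuation.

(** * Polynomial values on a set of clustering points *)

Lemma divided_difference (K : fieldType) (g : {poly K}) (a : K) :
  exists2 h : {poly K}, (size h <= (size g).-1)%N &
    forall y, g.[y] - g.[a] = h.[y] * (y - a).
Proof.
have /factor_theorem[h gE] : root (g - g.[a]%:P) a.
  by rewrite /root !hornerE subrr.
exists h => [|y]; last first.
  by have := congr1 (horner^~ y) gE; rewrite !hornerE.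
have [->|h0] := eqVneq h 0; first by rewrite size_poly0.
have := size_mul h0 (negbT (polyXsubC_eq0 a)).
rewrite -gE size_XsubC addn2 /= => sz.
have := size_polyD g (- g.[a]%:P); rewrite sz size_polyN size_polyC.
case: (size g) => [|n]; case: (g.[a] != 0) => //=.
Qed.

Section PolynomialValues.
Context {R : realType} {K : fieldType} (v : rank_one_valuation R K).
Variable E : set K.
Hypothesis E_no_divergent :
  ~ exists x : nat -> K, (forall n, E (x n)) /\ pseudo_divergent v x.
Hypothesis E_no_stationary :
  ~ exists x : nat -> K, (forall n, E (x n)) /\ pseudo_stationary v x.

(** Points at strictly decreasing valuation from a fixed point a form a
    pseudo-divergent sequence, the isosceles property giving
    v(x_n - x_m) = v(x_n - a) for m < n. *)
Lemma farthest_point a S : S `<=` E -> S !=set0 ->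
  exists2 b, S b & forall y, S y -> (v (b - a)%R <= v (y - a)%R)%E.
Proof.
move=> SE S0; apply: (attains_min (f := fun y => v (y - a)) S0).
move=> [x [Sx dec]]; apply: E_no_divergent; exists x.
split=> [n|n m l /andP[lm mn]]; first exact: SE.
have sub i j : (i < j)%N -> v (x j - x i) = v (x j - a).
  by move=> /dec /valuationBl; rewrite opprB addrA subrK.
by rewrite !sub //; exact: dec.
Qed.

(** On a sphere of valuation c, points in different open balls of valuation c
    are at distance exactly c; infinitely many such balls would provide a
    pseudo-stationary sequence, so one ball holds infinitely many points. *)
Lemma infinite_open_ball S (c : R) a : S `<=` E -> infinite_set S ->
  (forall y, S y -> v (y - a) = c%:E) ->
  exists S', [/\ S' `<=` S, infinite_set S' &
    forall y y', S' y -> S' y' -> (c%:E < v (y - y')%R)%E].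
Proof.
move=> SE Sinf Sa.
have [] := @finite_net _ S (fun z y => ~ (c%:E < v (y - z)%R)%E).
  case=> x [Sx xP]; apply: E_no_stationary; exists x.
  have xE i j : (i < j)%N -> v (x j - x i) = c%:E.
    move=> ij; apply/eqP; rewrite eq_le; apply/andP; split.
      by rewrite leNgt; apply/negP/xP.
    have -> : x j - x i = (x j - a) - (x i - a) by rewrite opprB addrA subrK.
    by rewrite valuationB_ge // Sa.
  split=> [n|]; first exact: SE.
  split=> [i j xij|n m l /andP[lm mn]]; last by rewrite !xE.
  apply: contrapT => /eqP; rewrite neq_ltn => /orP[] /xE;
    by rewrite xij subrr valuation0.
move=> s sS sN.
have [z zinf] : exists z, infinite_set (S `&` [set y | (c%:E < v (y - z)%R)%E]).
  apply: contrapT => /forallNP fin; apply: Sinf.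
  apply: (@sub_finite_set _ _
    (\bigcup_(z in [set` s]) (S `&` [set y | (c%:E < v (y - z)%R)%E]))).
    by move=> y Sy; have [z zs /contrapT cz] := sN y Sy; exists z.
  by apply: bigcup_finite => // z _; exact: contrapT (fin z).
exists (S `&` [set y | (c%:E < v (y - z)%R)%E]); split=> //.
by move=> y y' [_ yz] [_ y'z]; exact: valuationB_subr_gt yz y'z.
Qed.

(** If every sphere centred in S met S in a finite set, take b in S farthest
    from a: almost every y in S is strictly closer to a than b is, hence lies
    on the sphere of centre b through a, which is then infinite.  So some sphere
    meets S in an infinite set, and [infinite_open_ball] applies to it. *)
Lemma infinite_cluster S : S `<=` E -> infinite_set S ->
  exists a c S', [/\ S a, S' `<=` S, infinite_set S',
    forall y, S' y -> v (y - a) = c%:E &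
    forall y y', S' y -> S' y' -> (c%:E < v (y - y')%R)%E].
Proof.
move=> SE Sinf.
suff [a [c [Sa Tinf]]] :
    exists a (c : R), S a /\ infinite_set (S `&` [set y | v (y - a) = c%:E]).
  have TE : S `&` [set y | v (y - a) = c%:E] `<=` E by move=> y [/SE].
  have Ta y : (S `&` [set y | v (y - a) = c%:E]) y -> v (y - a) = c%:E by case.
  have [S' [S'T S'inf S'c]] := infinite_open_ball TE Tinf Ta.
  exists a, c, S'; split=> // y /S'T; by case.
apply: contrapT => nosphere.
have sphere a c : S a -> finite_set (S `&` [set y | v (y - a) = c]).
  move=> Sa; case: c => [c||].
  - by apply: contrapT => inf; apply: nosphere; exists a, c.
  - apply: sub_finite_set (finite_set1 a) => y [_ /valuation_pinfty/eqP].
    by rewrite subr_eq0 => /eqP.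
  - by apply: sub_finite_set (finite_set0 _) => y [_ /valuationNy].
have [a Sa] := infinite_setN0 Sinf.
have [b Sb bmin] := farthest_point a SE (ex_intro _ a Sa).
apply: (infinite_setD Sinf (sphere a (v (b - a)) Sa)).
apply: sub_finite_set (sphere b (v (b - a)) Sb) => y [Sy yP]; split=> //=.
have -> : y - b = (y - a) - (b - a) by rewrite opprB addrA subrK.
apply: valuationBr; rewrite lt_neqAle bmin // andbT.
by apply/eqP => yb; apply: yP; split.
Qed.

(** The hypothesis on g expresses that v o g tends downwards along S; in this
    form it does not depend on an enumeration and passes to infinite subsets.
    Beyond finitely many points v(g(y)) < v(g(a)), so the divided difference h
    at a satisfies v(h(y)) = v(g(y)) - c and inherits the hypothesis. *)
Lemma no_decreasing_values n (g : {poly K}) S : (size g <= n.+1)%N ->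
  S `<=` E -> infinite_set S ->
  ~ (forall x, S x ->
       finite_set (S `&` [set y | (v g.[x] <= v g.[y])%E])).
Proof.
elim: n g S => [|n IHn] g S szg SE Sinf dec.
  have [x Sx] := infinite_setN0 Sinf; apply: Sinf.
  apply: sub_finite_set (dec x Sx) => y Sy; split=> //=.
  by rewrite (size1_polyC szg) !hornerC.
have [a [c [S' [Sa S'S S'inf S'a _]]]] := infinite_cluster SE Sinf.
have [h szh hE] := divided_difference g a.
pose T := S' `\` (S `&` [set y | (v g.[a] <= v g.[y])%E]).
have TP y : T y -> [/\ S y, v (y - a) = c%:E & (v g.[y] < v g.[a])%E].
  move=> [S'y /not_andP ny]; have Sy := S'S _ S'y.
  by split=> //; [exact: S'a | case: ny => [//|/negP]; rewrite -ltNge].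
have vh y : T y -> (v h.[y] + c%:E)%E = v g.[y].
  by move=> /TP[_ <- /valuationBl]; rewrite hE valuationM.
apply: (IHn h T) => [|y /TP[/SE]//| |x Tx].
- by apply: leq_trans szh _; rewrite -ltnS; case: (size g) szg.
- exact: infinite_setD S'inf (dec a Sa).
have [Sx _ _] := TP x Tx.
apply: sub_finite_set (dec x Sx) => y [Ty /= xy]; have [Sy _ _] := TP y Ty.
by split=> //=; rewrite -!vh // leeD2r.
Qed.

Lemma polynomial_attains_min (g : {poly K}) : E !=set0 ->
  exists2 b, E b & forall y, E y -> (v g.[b] <= v g.[y])%E.
Proof.
move=> E0; apply: (attains_min (f := fun y => v g.[y]) E0) => -[x [Ex dec]].
apply: (@no_decreasing_values (size g) g (range x)).
- exact: leqnSn.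
- by move=> _ [n _ <-].
- apply: infinite_range => i j xij; apply: contrapT => /eqP.
  by rewrite neq_ltn => /orP[] /dec; rewrite xij ltxx.
move=> _ [m _ <-]; apply: (@sub_finite_set _ _ (x @` `I_m.+1)); last first.
  exact/finite_image/finite_II.
move=> _ [[n _ <-] /= mn]; exists n => //=; rewrite ltnS leqNgt.
by apply/negP => /dec; rewrite ltNge mn.
Qed.

(** The divided difference h at a inherits equidistance, with d - c for d: in
      (h(x) - h(y)) (x - a) = (g(x) - g(y)) - h(y) (x - y)
    the first term on the right has valuation d, and the second one more, as
    v(h(y)) = d - c and v(x - y) > c. *)
Lemma no_equidistant_values n (g : {poly K}) (d : R) S : (size g <= n.+1)%N ->
  S `<=` E -> infinite_set S ->
  ~ (forall x y, S x -> S y -> x != y -> v (g.[x] - g.[y]) = d%:E).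
Proof.
elim: n g d S => [|n IHn] g d S szg SE Sinf eqd.
  have [x Sx] := infinite_setN0 Sinf.
  have [y [Sy /= yx]] := infinite_setN0 (infinite_setD Sinf (finite_set1 x)).
  have := eqd y x Sy Sx; rewrite (size1_polyC szg) !hornerC subrr valuation0.
  by move/(_ (introN eqP yx)).
have [a [c [S' [Sa S'S S'inf S'a S'c]]]] := infinite_cluster SE Sinf.
have [h szh hE] := divided_difference g a.
apply: (IHn h (d - c) S') => [|y /S'S/SE//|//|x y S'x S'y xy].
  by apply: leq_trans szh _; rewrite -ltnS; case: (size g) szg.
have na z : S' z -> z != a.
  by move=> /S'a; apply: contra_eq_neq => ->; rewrite subrr valuation0.
have key : (h.[x] - h.[y]) * (x - a) = (g.[x] - g.[y]) - h.[y] * (x - y).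
  have -> : g.[x] - g.[y] = (g.[x] - g.[a]) - (g.[y] - g.[a]).
    by rewrite opprB addrA subrK.
  rewrite !hE mulrBl -addrA -opprD -mulrDr.
  by congr (_ - _ * _); rewrite [RHS]addrC addrA subrK.
have vg : v (g.[x] - g.[y]) = d%:E by apply: eqd => //; exact: S'S.
have vhy : (v h.[y] + c%:E)%E = d%:E.
  by rewrite -(S'a y S'y) -valuationM -hE eqd ?na //; exact: S'S.
have {}key : (v (h.[x] - h.[y])%R + c%:E)%E = d%:E.
  rewrite -{1}(S'a x S'x) -valuationM key valuationBl // vg valuationM.
  rewrite -vhy lteD2lE ?S'c //.
  by move: vhy; case: (v _).
by move: key; case: (v _) => //= r [<-]; rewrite addrK.
Qed.

Lemma finite_residues (f : {poly K}) : (forall x, E x -> (0 <= v f.[x])%E) ->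
  exists2 s : seq K, [set` s] `<=` E &
    forall y, E y -> exists2 z, z \in s & (0 < v (f.[y] - f.[z])%R)%E.
Proof.
move=> f0.
have [] := @finite_net _ E (fun z y => ~ (0 < v (f.[y] - f.[z])%R)%E).
  case=> x [Ex xP].
  have eq0 i j : (i < j)%N -> v (f.[x j] - f.[x i]) = 0%E.
    move=> ij; apply/eqP; rewrite eq_le valuationB_ge ?f0 // andbT.
    by rewrite leNgt; apply/negP/xP.
  apply: (@no_equidistant_values (size f) f 0 (range x)).
  - exact: leqnSn.
  - by move=> _ [n _ <-].
  - apply: infinite_range => i j xij; apply: contrapT => /eqP.
    by rewrite neq_ltn => /orP[] /eq0; rewrite xij subrr valuation0.
  - move=> _ _ [i _ <-] [j _ <-].
    have [/eq0|/eq0|->] := ltngtP i j; last by rewrite eqxx.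
      by rewrite valuationBC.
    by [].
by move=> s sE sN; exists s => // y /sN[z zs /contrapT]; exists z.
Qed.

End PolynomialValues.

(** * Prime ideals *)

Section PrimeIdeals.
Variable A : comNzRingType.

(** Classically every subset is decidable, so ideals given by boolean predicates
    are as general as ideals given by sets. *)
Lemma prime_idealr_of_set (I : set A) : I 0 -> ~ I 1 ->
  (forall a x y, I x -> I y -> I (a * x + y)) ->
  (forall x y, I (x * y) -> I x \/ I y) ->
  exists P : prime_idealr A, [set` P] = I.
Proof.
move=> I0 I1 IaD IM; pose S : A -> bool := fun x => `[< I x >].
have SE x : (x \in S) = `[< I x >] by [].
have Sideal : idealr_closed S.
  split=> [||a x y]; rewrite ?SE; first exact/asboolP.
    by apply/asboolPn.
  by move=> /asboolP Ix /asboolP Iy; apply/asboolP/IaD.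
have Sprime : prime_idealr_closed S.
  move=> x y; rewrite !SE => /asboolP/IM[Ix|Iy].
    by apply/orP; left; exact/asboolP.
  by apply/orP; right; exact/asboolP.
pose i1 := isIdealr.Build A S Sideal.
pose i2 := isPrimeIdealrClosed.Build A S Sprime.
pose P : prime_idealr A := HB.pack S i1 i2.
by exists P; apply/seteqP; split=> x /= /asboolP.
Qed.

Lemma prime_idealrX (P : prime_idealr A) (x : A) n : x ^+ n \in P -> x \in P.
Proof.
elim: n => [|n IHn]; first by rewrite expr0 idealr1.
by rewrite exprS prime_idealrM => /orP[].
Qed.

Lemma prime_idealr_prod (P : prime_idealr A) (I : eqType) (s : seq I)
    (F : I -> A) :
  \prod_(i <- s) F i \in P -> exists2 i, i \in s & F i \in P.
Proof.
elim: s => [|i s IHs]; first by rewrite big_nil idealr1.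
rewrite big_cons prime_idealrM => /orP[Fi|/IHs[j js Fj]].
  by exists i; rewrite ?mem_head.
by exists j; rewrite // inE js orbT.
Qed.

End PrimeIdeals.

(** * Integer-valued polynomials *)

Section IntegerValued.
Context {R : realType} {K : fieldType} (v : rank_one_valuation R K) (E : set K).
Local Notation D := (Int E v).
Implicit Types (f g : D) (c d : vring v).

Lemma Int_ge0 f x : E x -> (0 <= v (val f).[x])%E.
Proof. by have /asboolP := valP f; apply. Qed.

Lemma intval_lift (p : {poly K}) : (forall x, E x -> (0 <= v p.[x])%E) ->
  exists f : D, val f = p.
Proof. by move=> /asboolP pP; exists (IntPoly pP). Qed.

Lemma int_const_is_zmod_morphism : zmod_morphism (@int_const R K E v).
Proof.
move=> c d; apply: val_inj.
by rewrite [RHS]rmorphB /= -polyCB -(rmorphB (\val : vring v -> K)).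
Qed.

Lemma int_const_is_monoid_morphism : monoid_morphism (@int_const R K E v).
Proof.
split=> [|c d]; apply: val_inj; first by rewrite [RHS]rmorph1 /= -polyC1.
by rewrite [RHS]rmorphM /= -polyCM -(rmorphM (\val : vring v -> K)).
Qed.

HB.instance Definition _ := GRing.isZmodMorphism.Build (vring v) D
  (@int_const R K E v) int_const_is_zmod_morphism.
HB.instance Definition _ := GRing.isMonoidMorphism.Build (vring v) D
  (@int_const R K E v) int_const_is_monoid_morphism.

Local Notation cst c := (int_const E c : D).

Lemma idealr_const (J : idealr D) c : cst c \in J -> (0 < v (val c))%E.
Proof.
move=> cJ; rewrite lt_neqAle vring_val_ge0 andbT; apply/eqP => c0.
have cN0 : val c != 0.
  by apply/eqP => /(valuation_pinfty v); rewrite -c0.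
have [|d dE] := @vring_lift _ _ v (val c)^-1.
  by rewrite valuationV // -c0 oppe0.
suff : cst d * cst c \in J.
  suff -> : cst d * cst c = 1 by rewrite idealr1.
  by rewrite -rmorphM -(rmorph1 (@int_const R K E v)); congr int_const;
     apply: val_inj; rewrite rmorphM rmorph1 /= dE mulVf.
exact: idealMr.
Qed.

Lemma lies_over_max_const (P : prime_idealr D) c :
  lies_over [set` P] [set` vmax v] -> (cst c \in P) = (0 < v (val c))%E.
Proof. by move=> /(congr1 (@^~ c)) /= PE; apply/idP/idP; rewrite PE. Qed.

(** Rank one makes m the only nonzero prime of V: if c is a nonzero constant in
    P and b is in m, then c divides a power of b. *)
Lemma prime_lies_over (P : prime_idealr D) :
  lies_over [set` P] [set 0] \/ lies_over [set` P] [set` vmax v].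
Proof.
have [[c [c0 cP]]|noc] := pselect (exists c, c != 0 /\ cst c \in P).
  right; apply/seteqP; split=> d /=; first exact: idealr_const.
  move=> d0.
  have cK0 : val c != 0 by [].
  have [n cd] := rank_one_archimedean cK0 d0.
  apply: (@prime_idealrX _ _ _ n).
  have [|e eE] := @vring_lift _ _ v (val d ^+ n / val c).
    rewrite valuationM valuationV // sube_ge0 //.
    by have [r ->] := valuation_fin v cK0.
  suff -> : cst d ^+ n = cst e * cst c by exact: idealMr.
  rewrite -rmorphXn -rmorphM; congr int_const; apply: val_inj.
  by rewrite rmorphM rmorphXn /= eE divfK.
left; apply/seteqP; split=> [d /= dP|_ -> /=]; last by rewrite rmorph0 idealr0.
by apply: contrapT => /eqP d0; apply: noc; exists d.
Qed.

(** f is t times the integer-valued polynomial f / t, and the constant t is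
    in P. *)
Lemma bounded_below_mem (P : prime_idealr D) f t :
  lies_over [set` P] [set` vmax v] -> t != 0 -> (0 < v t)%E ->
  (forall x, E x -> (v t <= v (val f).[x])%E) -> f \in P.
Proof.
move=> Pm t0 vt tf.
have [c cE] := vring_lift (ltW vt).
have [|g gE] := @intval_lift (t^-1 *: val f).
  move=> x Ex; rewrite hornerZ valuationM valuationV // addeC sube_ge0 ?tf //.
  by have [r ->] := valuation_fin v t0.
suff -> : f = g * cst c by rewrite idealMr // lies_over_max_const ?cE.
apply: val_inj; rewrite rmorphM /= gE -[vring_val c]/(val c) cE.
by rewrite mulrC mul_polyC scalerA divff // scale1r.
Qed.

(** Primality is where U has to be an ultrafilter: if the set where f is in m is
    not in U, then its complement is, and there g must account for fg. *)
Lemma ultra_ideal (U : set_system E) : UltraFilter U ->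
  exists P : prime_idealr D,
    [set` P] = m_ultra U /\ lies_over [set` P] [set` vmax v].
Proof.
move=> UU; have E_in (x : E) : E (val x) by exact: set_valP.
have [||||P PE] := @prime_idealr_of_set D (m_ultra U).
- apply: filterS filterT => x _.
  by rewrite /preim_max /= horner0 valuation0 lt0y.
- suff -> : m_ultra U (1 : D) = U set0 by exact: filter_not_empty.
  rewrite /m_ultra /=; congr (U _); apply/seteqP; split=> x //=.
  by rewrite /preim_max /= hornerC valuation1 ltxx.
- move=> a f g; apply: filterS2 => x /= fx gx.
  rewrite /preim_max /= hornerD hornerM.
  apply: lt_le_trans (valuationD v _ _); rewrite lt_min gx andbT valuationM.
  by rewrite (lt_le_trans fx) // leeDr //; exact: (Int_ge0 a (E_in x)).
- move=> f g Ufg.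
  have [|Uf] := in_ultra_setVsetC (preim_max f) UU; first by left.
  right; apply: filterS2 Uf Ufg => x /= /negP; rewrite -leNgt => fx.
  rewrite /preim_max /= hornerM valuationM => /lt_le_trans; apply.
  by rewrite -[leRHS]add0e leeD2r.
exists P; split=> //; apply/seteqP; split=> c /=; first exact: idealr_const.
move=> c0; suff : m_ultra U (cst c) by rewrite -PE.
by apply: filterS filterT => x _; rewrite /preim_max /= hornerC.
Qed.

(** * Primes over the maximal ideal *)

Section NoBadSequence.
Local Open Scope quotient_scope.
Hypothesis E_no_divergent :
  ~ exists x : nat -> K, (forall n, E (x n)) /\ pseudo_divergent v x.
Hypothesis E_no_stationary :
  ~ exists x : nat -> K, (forall n, E (x n)) /\ pseudo_stationary v x.
Hypothesis E_neq0 : E !=set0.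

(** The valuations of the values of f on E, each positive, have a minimum, so
    they cannot tend to 0 and some t in m divides f. *)
Lemma max_valued_mem (P : prime_idealr D) f :
  lies_over [set` P] [set` vmax v] ->
  (forall x, E x -> (0 < v (val f).[x])%E) -> f \in P.
Proof.
move=> Pm f0.
have [b Eb bmin] :=
  polynomial_attains_min E_no_divergent E_no_stationary (val f) E_neq0.
have [fb0|fbN0] := eqVneq (val f).[b] 0; last first.
  exact: bounded_below_mem Pm fbN0 (f0 b Eb) bmin.
(* f vanishes on E: any nonzero t in m divides it. *)
have [t t0 vt] := exists_valuation_gt0 v.
apply: bounded_below_mem Pm t0 vt _ => x Ex.
by apply: le_trans (bmin x Ex); rewrite fb0 valuation0 leey.
Qed.

(** The product of the f - c, for c running through representatives of the
    finitely many residues of f on E, takes its values in m. *)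
Lemma constant_residue (P : prime_idealr D) f :
  lies_over [set` P] [set` vmax v] -> exists c, f - cst c \in P.
Proof.
move=> Pm.
have [s sE sP] := finite_residues E_no_divergent E_no_stationary (@Int_ge0 f).
pose c z : vring v := insubd 0 (val f).[z].
have cE z : E z -> val (c z) = (val f).[z].
  by move=> Ez; rewrite insubdK //; exact: Int_ge0.
have : \prod_(z <- s) (f - cst (c z)) \in P.
  apply: max_valued_mem Pm _ => x Ex; have [z zs xz] := sP x Ex.
  rewrite (big_rem z zs) /= hornerM hornerD hornerN hornerC valuationM.
  rewrite -[vring_val _]/(val (c z)) (cE z (sE z zs)).
  by rewrite (lt_le_trans xz) // leeDl // Int_ge0.
by case/prime_idealr_prod => z _ fz; exists (c z).
Qed.

(** An f in a larger proper ideal J is congruent modulo P to a constant, which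
    lies in J, hence is not a unit of V, hence is in m. *)
Lemma lies_over_max_maximal (P : prime_idealr D) :
  lies_over [set` P] [set` vmax v] -> is_maximal P.
Proof.
move=> Pm J PJ; apply/seteqP; split=> // f /= fJ.
have [c fc] := constant_residue f Pm; rewrite -(subrK (cst c) f) rpredD //.
rewrite lies_over_max_const // (@idealr_const J) //.
by rewrite -(subKr f (cst c)) rpredB //; exact: PJ.
Qed.

Lemma lies_over_max_ultra (P : prime_idealr D) :
  lies_over [set` P] [set` vmax v] ->
  exists U : set_system E, UltraFilter U /\ [set` P] = m_ultra U.
Proof.
move=> Pm.
(* The inclusion m_U <= P holds exactly when U contains, for each h outside P,
   the set where h takes unit values. *)
pose F : set_system E :=
  [set A | exists2 h, h \notin P & ~` preim_max h `<=` A].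
have FF : ProperFilter F.
  split; last split.
  - case=> h /negP hP hsub; apply: hP.
    apply: max_valued_mem Pm _ => x Ex; apply: contrapT => hx.
    exact: (hsub (SigSub (mem_set Ex))).
  - by exists 1 => //; rewrite idealr1.
  - move=> A B [h hP hA] [g gP gB]; exists (h * g).
      by rewrite prime_idealrM negb_or hP.
    move=> x hgx; split; [apply: hA | apply: gB] => pos; apply: hgx;
      rewrite /preim_max /= hornerM valuationM (lt_le_trans pos) //.
      by rewrite leeDl //; exact: (Int_ge0 g (set_valP x)).
    by rewrite leeDr //; exact: (Int_ge0 h (set_valP x)).
  - by move=> A B AB [h hP hA]; exists h => // x /hA/AB.
have [U [UU FU]] := ultraFilterLemma FF.
have [Q [QU Qm]] := ultra_ideal UU.
exists U; split=> //; rewrite -QU; apply: lies_over_max_maximal Qm _ _.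
rewrite QU => f Uf /=; apply: contrapT => /negP fP.
apply: (@filter_not_empty _ U); rewrite -(setICr (preim_max f)).
by apply: filterI => //; apply: FU; exists f.
Qed.

Lemma lies_over_max_residue_field (P : prime_idealr D) :
  lies_over [set` P] [set` vmax v] ->
  ring_isomorphic {ideal_quot P} {ideal_quot (vmax v)}.
Proof.
move=> Pm.
have [c cP] := choice (fun f => constant_residue f Pm).
pose QP := {ideal_quot P}; pose QV := {ideal_quot (vmax v)}.
(* The inverse of the map V / m -> Int / P induced by the constants. *)
pose phi (x : QP) : QV := \pi_QV (c (repr x)).
have mod_vmax f d e : f - cst d \in P -> f - cst e \in P -> \pi_QV d = \pi_QV e.
  move=> fd fe; apply/eqP; rewrite -Quotient.idealrBE.
  change (is_true (0 < v (val (d - e)%R))%E).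
  rewrite -(lies_over_max_const _ Pm) rmorphB.
  have -> : cst d - cst e = (f - cst e) - (f - cst d).
    by rewrite opprB [RHS]addrC subrKA.
  exact: rpredB.
have phi_pi f d : f - cst d \in P -> phi (\pi_QP f) = \pi_QV d.
  move=> fd; apply/esym/(mod_vmax f) => //.
  rewrite -(subrKA (repr (\pi_QP f))) rpredD ?cP //.
  by rewrite Quotient.idealrBE reprK.
have phiB : zmod_morphism phi.
  elim/quotW=> f; elim/quotW=> g.
  rewrite (phi_pi _ _ (cP f)) (phi_pi _ _ (cP g)) -!rmorphB; apply: phi_pi.
  by rewrite rmorphB opprD addrACA -opprD rpredB.
have phiM : monoid_morphism phi.
  split.
    by rewrite -(rmorph1 \pi_QP) (phi_pi _ 1) ?rmorph1 ?subrr ?idealr0.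
  elim/quotW=> f; elim/quotW=> g.
  rewrite (phi_pi _ _ (cP f)) (phi_pi _ _ (cP g)) -!rmorphM; apply: phi_pi.
  rewrite rmorphM /=.
  have -> : f * g - cst (c f) * cst (c g) =
      g * (f - cst (c f)) + cst (c f) * (g - cst (c g)).
    by rewrite !mulrBr addrA (mulrC g f) (mulrC g) subrK.
  by rewrite rpredD ?idealMr.
pose m1 := GRing.isZmodMorphism.Build QP QV phi phiB.
pose m2 := GRing.isMonoidMorphism.Build QP QV phi phiM.
pose phiR : {rmorphism QP -> QV} := HB.pack phi m1 m2.
exists phiR; exists (fun d : QV => \pi_QP (cst (repr d))); last first.
  elim/quotW=> d /=; rewrite (phi_pi _ (repr (\pi_QV d))) ?reprK //.
  by rewrite subrr idealr0.
elim/quotW=> f /=; rewrite (phi_pi _ _ (cP f)).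
apply/eqP; rewrite eq_sym -Quotient.idealrBE.
set r := repr _; rewrite -(subrKA (cst (c f))) rpredD ?cP //.
rewrite -rmorphB lies_over_max_const //.
change (is_true (c f - r \in vmax v)); rewrite Quotient.idealrBE.
by rewrite reprK.
Qed.

End NoBadSequence.
End IntegerValued.

(** * Primes over zero *)

Section OverZero.
Context {R : realType} {K : fieldType} (v : rank_one_valuation R K) (E : set K).
Local Notation D := (Int E v).
Implicit Types (f g : D) (c d : vring v).
Local Notation cst c := (int_const E c : D).
Hypothesis E_sub_V : E `<=` [set` val_dom v].

Lemma val_cstM c f : val (cst c * f) = val c *: val f.
Proof. by rewrite -mul_polyC. Qed.

Lemma clear_denominator (x : K) : exists2 d : vring v, val d != 0 &
  (0 <= v (val d * x)%R)%E.
Proof.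
have [x0|x0] := leP 0%E (v x).
  by exists 1; rewrite ?rmorph1 ?oner_neq0 ?mul1r.
have xN0 : x != 0 by apply: contraTneq x0 => ->; rewrite valuation0.
have [|d dE] := @vring_lift _ _ v x^-1.
  by rewrite valuationV // oppe_ge0 ltW.
by exists d; rewrite dE ?invr_eq0 // mulVf // valuation1.
Qed.

(** Since X itself is integer-valued on E, only coefficients matter: K[X] is
    Int(E, V) with the nonzero constants inverted. *)
Lemma clear_denominators (p : {poly K}) : exists2 d : vring v, val d != 0 &
  exists f, val f = val d *: p.
Proof.
elim/poly_ind: p => [|p a [d d0 [f fE]]].
  by exists 1; [rewrite rmorph1 oner_neq0 | exists 0; rewrite rmorph0 scaler0].
have [e e0 ea] := clear_denominator a.
exists (d * e); first by rewrite rmorphM mulf_neq0.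
apply: intval_lift => x Ex; rewrite hornerZ hornerMXaddC rmorphM.
have -> : val d * val e * (p.[x] * x + a) =
    val e * (val f).[x] * x + val d * (val e * a).
  rewrite fE hornerZ mulrDr; congr (_ + _); last by rewrite mulrA.
  by rewrite !mulrA (mulrC (val d)).
apply: le_trans (valuationD v _ _); rewrite le_min !(valuationM v _ x).
rewrite !(valuationM v (val _)) -(valuationM v _ a).
by rewrite !adde_ge0 ?vring_val_ge0 ?Int_ge0 //; exact: E_sub_V.
Qed.

Lemma prime_of_polyP q f : prime_of_poly q f <-> q %| val f.
Proof.
by split=> [[h fE]|/dvdpP[h fE]]; [apply/dvdpP|]; exists h; rewrite mulrC.
Qed.

Lemma irreducible_dvdM (q a b : {poly K}) : irreducible_poly q ->
  q %| a * b -> q %| a \/ q %| b.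
Proof.
move=> irr qab; have [|qa] := boolP (q %| a); [by left|right].
by rewrite -(Gauss_dvdpr b (q := a)) // irreducible_poly_coprime.
Qed.

Lemma prime_of_poly_prime (q : {poly K}) : irreducible_poly q ->
  exists P : prime_idealr D,
    [/\ [set` P] = prime_of_poly q, prime_of_poly q <> [set (0 : D)] &
        lies_over [set` P] [set 0]].
Proof.
move=> irr; have q0 := irredp_neq0 irr; have sq := irr.1.
have const0 a : q %| a%:P -> a = 0.
  move=> qa; apply/eqP; apply: contraLR sq => a0.
  by rewrite -leqNgt (leq_trans (dvdp_leq _ qa)) ?polyC_eq0 ?size_polyC_leq1.
have [||||P PE] := @prime_idealr_of_set D (prime_of_poly q).
- by apply/prime_of_polyP; rewrite rmorph0 dvdp0.
- by move=> /prime_of_polyP /const0/eqP; rewrite oner_eq0.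
- move=> a f g /prime_of_polyP qf /prime_of_polyP qg; apply/prime_of_polyP.
  by rewrite rmorphD rmorphM dvdp_add // dvdp_mull.
- move=> f g /prime_of_polyP; rewrite rmorphM => /(irreducible_dvdM irr).
  by case=> /prime_of_polyP; [left|right].
exists P; split=> // [q_eq0|].
  have [d d0 [f fE]] := clear_denominators q.
  have : prime_of_poly q f by apply/prime_of_polyP; rewrite fE dvdpZr.
  rewrite q_eq0 => /= f0; move: fE; rewrite f0 rmorph0 => /esym/eqP.
  by rewrite scaler_eq0 (negPf d0) (negPf q0).
apply/seteqP; split=> [c /= cP|_ -> /=]; last by rewrite rmorph0 idealr0.
have : prime_of_poly q (cst c) by rewrite -PE.
by move=> /prime_of_polyP /const0 c0; exact: val_inj.
Qed.

Lemma prime_of_poly_sub (q q' : {poly K}) :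
  q \is monic -> irreducible_poly q -> q' \is monic -> irreducible_poly q' ->
  prime_of_poly q `<=` (prime_of_poly q' : set D) -> q = q'.
Proof.
move=> mq irr mq' irr' qq'; have [d d0 [f fE]] := clear_denominators q.
have /qq'/prime_of_polyP : prime_of_poly q f.
  by apply/prime_of_polyP; rewrite fE dvdpZr.
rewrite fE dvdpZr // => q'q; apply/esym/eqP; rewrite -eqp_monic //.
by apply: irr.2 q'q; rewrite gtn_eqF // irr'.1.
Qed.

Section PrimeOverZero.
Variable P : prime_idealr D.
Hypothesis P_over0 : lies_over [set` P] [set 0].

Lemma lies_over0_const c : (cst c \in P) = (c == 0).
Proof.
have /= PE := congr1 (@^~ c) P_over0.
by apply/idP/eqP => [|->]; [rewrite PE | rewrite rmorph0 idealr0].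
Qed.

Lemma over0_scale d f g : val d != 0 -> val g = val d *: val f ->
  (g \in P) = (f \in P).
Proof.
move=> d0 gE; have -> : g = cst d * f by apply: val_inj; rewrite val_cstM.
by rewrite prime_idealrM lies_over0_const [d == 0](negPf d0).
Qed.

(** Division by an element g of least degree: after clearing denominators the
    remainder is again in P and has smaller degree, so it vanishes.
    Conversely, if g divides f in K[X], some nonzero constant multiple
    of f is a multiple of g in Int(E, V), and P, which contains no nonzero
    constant, contains f. *)
Lemma over0_generator : [set` P] <> [set 0] ->
  exists2 q : {poly K}, q \is monic & forall f, (f \in P) = (q %| val f).
Proof.
move=> PN0.
have exf : exists n, `[< exists f, [/\ f \in P, f != 0 & size (val f) = n] >].
  apply: contrapT => nof; apply: PN0; apply/seteqP; split=> [f /= fP|_ -> /=].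
    apply: contrapT => /eqP f0; apply: nof; exists (size (val f)).
    by apply/asboolP; exists f.
  exact: idealr0.
case: (ex_minnP exf) => n /asboolP[g [gP g0 gn]] nmin.
have vg0 : val g != 0 by [].
have dvd_gen f : (f \in P) = (val g %| val f).
  have [d d0 [h hE]] := clear_denominators (val f %/ val g).
  pose r : D := cst d * f - h * g.
  have rE : val r = val d *: (val f %% val g).
    have -> : val r = val d *: val f - val h * val g by rewrite -mul_polyC.
    rewrite hE -scalerAl -scalerBr; congr (_ *: _).
    by rewrite {1}(divp_eq (val f) (val g)) addrAC subrr add0r.
  have -> : (f \in P) = (r \in P).
    rewrite /r -[RHS](rpredDr _ (idealMr h gP)) subrK.
    by rewrite (over0_scale d0 (val_cstM d f)).
  apply/idP/idP => [rP|].
    rewrite /dvdp -size_poly_leq0 leqNgt; apply/negP => sr.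
    have : (n <= size (val r))%N.
      apply/nmin/asboolP; exists r; split=> //.
      by rewrite -(inj_eq val_inj) rE scaler_eq0 (negPf d0) -size_poly_gt0.
    by rewrite rE size_scale // -gn leqNgt ltn_modp vg0.
  move=> /eqP fg; suff -> : r = 0 by exact: idealr0.
  by apply: val_inj; rewrite rE fg scaler0 rmorph0.
pose c := (lead_coef (val g))^-1.
have c0 : c != 0 by rewrite invr_eq0 lead_coef_eq0.
exists (c *: val g); last by move=> f; rewrite dvdpZl.
by rewrite monicE lead_coefZ mulVf // lead_coef_eq0.
Qed.

(** A factorization of q becomes, up to a nonzero constant, a product of
    integer-valued polynomials in P, one of which is then divisible by q. *)
Lemma over0_irreducible (q : {poly K}) : q != 0 ->
  (forall f, (f \in P) = (q %| val f)) -> irreducible_poly q.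
Proof.
move=> q0 PE; split=> [|a a1 /dvdpP[b qab]].
  rewrite ltnNge; apply/negP => sq.
  have q1 : q %= 1 by rewrite -size_poly_eq1 eqn_leq sq size_poly_gt0.
  have : (1 : D) \in P by rewrite PE (eqp_dvdl _ q1) dvd1p.
  by rewrite idealr1.
have [d d0 [f fE]] := clear_denominators a.
have [e e0 [g gE]] := clear_denominators b.
have : g * f \in P.
  rewrite PE -[val (g * f)]/(val g * val f) gE fE qab.
  by rewrite -scalerAl -scalerAr !dvdpZr.
rewrite prime_idealrM !PE gE fE !dvdpZr // => /orP[qb|qa].
  have [b0 a0] : b != 0 /\ a != 0 by apply/norP; rewrite -mulf_eq0 -qab.
  have := dvdp_leq b0 qb; rewrite qab size_mul //.
  move: a0 a1; rewrite -size_poly_gt0; case: (size a) => [|[|n]] // _ _.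
  by rewrite addnS /= addnS ltnNge leq_addr.
by rewrite /eqp qa qab dvdp_mull.
Qed.

Lemma over0_prime_of_poly : [set` P] <> [set 0] ->
  exists q : {poly K}, [/\ q \is monic, irreducible_poly q &
    prime_of_poly q = [set` P]].
Proof.
move=> /over0_generator[q mq PE]; exists q; split=> //.
  exact: over0_irreducible (monic_neq0 mq) PE.
apply/seteqP; split=> f; first by move=> /prime_of_polyP; rewrite -PE.
by rewrite /= PE => qf; apply/prime_of_polyP.
Qed.

End PrimeOverZero.
End OverZero.

(** * Krull dimension *)

Section Dimension.
Context {R : realType} {K : fieldType} (v : rank_one_valuation R K) (E : set K).
Local Notation D := (Int E v).

Lemma zero_prime : exists P : prime_idealr D, [set` P] = [set 0].
Proof.
apply: prime_idealr_of_set => //=; first by apply/eqP; exact: oner_neq0.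
  by move=> a x y -> ->; rewrite mulr0 addr0.
move=> f g /(congr1 val)/eqP; rewrite rmorph0 /= mulf_eq0.
by case/orP=> /eqP f0; [left|right]; exact: val_inj.
Qed.

Lemma over0_eq (P Q : prime_idealr D) : E `<=` [set` val_dom v] ->
  lies_over [set` P] [set 0] -> [set` P] <> [set 0] ->
  lies_over [set` Q] [set 0] -> [set` P] `<=` [set` Q] -> [set` P] = [set` Q].
Proof.
move=> E_sub_V P0 PN0 Q0 PQ.
have [q [mq irr qP]] := over0_prime_of_poly E_sub_V P0 PN0.
have QN0 : [set` Q] <> [set 0].
  move=> QE; apply: PN0; apply/seteqP; split=> [|_ -> /=]; last exact: idealr0.
  by rewrite -QE.
have [q' [mq' irr' qQ]] := over0_prime_of_poly E_sub_V Q0 QN0.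
rewrite -qP -qQ; congr prime_of_poly.
by apply: (prime_of_poly_sub E_sub_V mq irr mq' irr'); rewrite qP qQ.
Qed.

(** In a chain P_0 < P_1 < P_2 < P_3, neither P_1 nor P_2 is maximal, so both
    lie over 0; being nonzero and comparable they coincide. *)
Lemma chain_length_le2 m (P : 'I_m.+1 -> prime_idealr D) :
  E `<=` [set` val_dom v] ->
  (forall Q : prime_idealr D,
     lies_over [set` Q] [set` vmax v] -> is_maximal Q) ->
  prime_chain P -> (m <= 2)%N.
Proof.
move=> E_sub_V maxQ chainP; rewrite leqNgt; apply/negP => m2.
have chain i j : (i < j <= m)%N -> [set` P (inord i)] `<` [set` P (inord j)].
  by move=> /andP[ij jm]; apply: chainP; rewrite !inordK // (ltn_trans ij).
have below_over0 i j : (i < j <= m)%N ->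
    lies_over [set` P (inord i)] [set 0].
  move=> ij; have [//|/maxQ Pmax] := prime_lies_over (P (inord i)).
  by case: (chain i j ij) => /Pmax ->; case.
have [_ N10] := chain 0 1 (ltnW (ltnW m2)).
have [sub12] := chain 1 2 (ltnW m2); apply.
have over1 := below_over0 1 2 (ltnW m2); have over2 := below_over0 2 3 m2.
rewrite -(over0_eq E_sub_V over1 _ over2) //.
by move=> P10; apply: N10; rewrite P10 => _ ->; exact: idealr0.
Qed.

Lemma chain_length2 : E `<=` [set` val_dom v] -> E !=set0 ->
  exists P : 'I_3 -> prime_idealr D, prime_chain P.
Proof.
move=> E_sub_V [a Ea].
have [P0 P0E] := zero_prime.
have [P1 [P1E P1N0 P1over]] :=
  prime_of_poly_prime E_sub_V (irredp_XsubC a).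
pose x : E := SigSub (mem_set Ea).
have [P2 [P2E P2over]] := ultra_ideal v (principal_filter_ultra x).
have P01 : [set` P0] `<` [set` P1].
  split=> [|P10]; first by rewrite P0E => _ ->; exact: idealr0.
  apply: P1N0; rewrite -P1E; apply/seteqP; split; first by rewrite -P0E.
  by move=> _ ->; exact: idealr0.
have P12 : [set` P1] `<` [set` P2].
  split=> [|P21].
    rewrite P1E P2E => f [h fE] _ ->; rewrite /preim_max /= fE hornerM.
    by rewrite hornerXsubC subrr mul0r valuation0 lt0y.
  have [t t0 vt] := exists_valuation_gt0 v.
  have [c cE] := vring_lift (ltW vt).
  have : [set c : vring v | [set` P1] (int_const E c)] c.
    by apply: P21; rewrite /= lies_over_max_const // cE.
  by rewrite P1over /= => c0; move: t0; rewrite -cE c0 rmorph0 eqxx.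
exists (fun i => nth P0 [:: P0; P1; P2] i).
case=> [[|[|[|//]]] i3]; case=> [[|[|[|//]]] j3] //= _.
case: P01 P12 => [sub01 _] [sub12 N21]; split; first exact: subset_trans sub12.
by move=> sub20; apply: N21; exact: subset_trans sub01.
Qed.

End Dimension.

Theorem theorem3p5 (R : realType) (K : fieldType) (v : rank_one_valuation R K)
    (E : set K) (E_neq0 : E !=set0) (E_sub_V : E `<=` [set` val_dom v])
    (E_no_divergent :
       ~ exists x : nat -> K, (forall n, E (x n)) /\ pseudo_divergent v x)
    (E_no_stationary :
       ~ exists x : nat -> K, (forall n, E (x n)) /\ pseudo_stationary v x) :
  [/\ forall P : prime_idealr (Int E v),
        lies_over [set` P] [set 0] \/ lies_over [set` P] [set` vmax v],
      set_bij [set q : {poly K} | q \is monic /\ irreducible_poly q]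
        [set I : set (Int E v) | exists P : prime_idealr (Int E v),
           [/\ I = [set` P], I <> [set 0] & lies_over I [set 0]]]
        (@prime_of_poly R K E v),
      forall P : prime_idealr (Int E v), lies_over [set` P] [set` vmax v] ->
        is_maximal P /\ ring_isomorphic {ideal_quot P} {ideal_quot (vmax v)},
      forall I : set (Int E v),
        (exists P : prime_idealr (Int E v),
           I = [set` P] /\ lies_over I [set` vmax v]) <->
        (exists U : set_system E, UltraFilter U /\ I = m_ultra U) &
      has_krull_dim (Int E v) 2].
Proof.
have over_max (P : prime_idealr (Int E v)) :
    lies_over [set` P] [set` vmax v] -> is_maximal P.
  exact: lies_over_max_maximal.
split.
- exact: prime_lies_over.
- split.
  + move=> q [mq irr].
    have [P [PE qN0 P0]] := prime_of_poly_prime E_sub_V irr.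
    by exists P; rewrite PE in P0 *.
  + move=> q q' /set_mem[mq irr] /set_mem[mq' irr'] qq'.
    by apply: (prime_of_poly_sub E_sub_V mq irr mq' irr'); rewrite qq'.
  + move=> _ [P [-> PN0 P0]].
    by have [q [mq irr qP]] := over0_prime_of_poly E_sub_V P0 PN0; exists q.
- by move=> P Pm; split; [exact: over_max | exact: lies_over_max_residue_field].
- move=> I; split=> [[P [-> Pm]]|[U [UU ->]]].
    exact: lies_over_max_ultra.
  by have [P [PE Pm]] := ultra_ideal v UU; exists P; rewrite -PE.
- split; first exact: chain_length2.
  by move=> m P; exact: chain_length_le2.
Qed.
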